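(* Let $M$ be a compact connected oriented $3$-manifold with an oriented ideal triangulation $\mathcal T$ with $v$ $0$-cells, and let $\sigma$ be a $\mathbb Z/2\mathbb Z$-valued $2$-cocycle on $\widehat M$. There exist $1$-cells $\varepsilon_1,\dots,\varepsilon_v$ of $\mathcal T$ such that the reduced Ptolemy variety $P_2^{\sigma}(\mathcal T)_{\mathrm{red}}$ is naturally isomorphic to the subvariety of $P^\sigma_2(\mathcal T)$ obtained by intersecting with the affine subspace $c_{\varepsilon_1}=\dots=c_{\varepsilon_v}=1$ (that is, the inclusion of this subvariety into $P_2^\sigma(\mathcal T)$ followed by the quotient map $P_2^\sigma(\mathcal T)\to P_2^\sigma(\mathcal T)_{\mathrm{red}}$ is an isomorphism).
   Context: $M$ is a compact connected oriented $3$-manifold with non-empty boundary; $\widehat M$ is the space obtained from $M$ by collapsing each boundary component (called a cusp) to a point. An ideal triangulation $\mathcal T$ of $M$ is an identification of $\widehat M$ with a space obtained from finitely many simplices $\Delta_k$ by gluing faces in pairs by affine homeomorphisms, such that the $0$-cells correspond to the boundary components of $M$. Each $\Delta_k$ is identified with a standard simplex with vertices $0,1,2,3$; $\mathcal T$ is oriented if these identifications preserve orientation. $v$ and $e$ are the numbers of $0$-cells and $1$-cells. $\varepsilon_{ij,k}$ is the oriented edge of $\Delta_k$ from vertex $i$ to vertex $j$, and $\sim$ denotes identification in $\widehat M$. A $\mathbb Z/2\mathbb Z$-valued $2$-cocycle $\sigma$ on $\widehat M$ is a sign for each face of $\mathcal T$ with product $1$ over the four faces of each simplex; $\sigma_{i,k}$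 is the sign of the face of $\Delta_k$ opposite vertex $i$. The Ptolemy variety $P_2^\sigma(\mathcal T)$ is the set of assignments of non-zero complex numbers $c_{ij,k}$ (Ptolemy coordinates) to the oriented edges $\varepsilon_{ij,k}$ with $c_{ij,k}=-c_{ji,k}$, $c_{ij,k}=c_{i'j',k'}$ whenever $\varepsilon_{ij,k}\sim\varepsilon_{i'j',k'}$, and for every $k$ $$\sigma_{0,k}\sigma_{3,k}c_{03,k}c_{12,k}+\sigma_{0,k}\sigma_{1,k}c_{01,k}c_{23,k}=\sigma_{0,k}\sigma_{2,k}c_{02,k}c_{13,k}.$$ Choosing an oriented representative of each $1$-cell, $P_2^\sigma(\mathcal T)\subset(\mathbb C^* )^e$ with coordinates $c_\varepsilon$ indexed by the $1$-cells $\varepsilon$ of $\mathcal T$. The torus $T=(\mathbb C^* )^v$, with coordinates indexed by the cusps, acts on $P_2^\sigma(\mathcal T)$ by $(xc)_i=x_jx_kc_i$, where $j,k$ (possibly equal) are the cusps at the ends of the $i$th $1$-cell. $P^\sigma_2(\mathcal T)_{\mathrm{red}}=P_2^\sigma(\mathcal T)/T$ is the quotient variety, whose coordinate ring is the ring of invariants $\mathcal O^T$ of the coordinate ring $\mathcal O$ of $P_2^\sigma(\mathcal T)$. *)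

(* Defs.v *)
From HB Require Import structures.
From Stdlib Require Import Relation_Operators.
From mathcomp Require Import all_boot all_order all_algebra all_fingroup.
From mathcomp Require Import boolp classical_sets functions reals topology.
From mathcomp Require Import normedtype complex.

Set Implicit Arguments.
Unset Strict Implicit.
Unset Printing Implicit Defensive.

Import Order.TTheory GRing.Theory Num.Theory.
Import numFieldNormedType.Exports.

Local Open Scope classical_set_scope.
Local Open Scope ring_scope.
Local Open Scope complex_scope.

Section Manifolds.
Variable R : realType.

(* f, a homeomorphism near p, has local degree 1 at p: on every small sphere
   around p, the map u |-> f (p + e u) - f p is homotopic, as a map from the
   unit sphere to R^3 minus the origin, to the inclusion.  By Hopf's theorem
   this says that f preserves the local orientation at p. *)
Definition preserves_orientation_at (f : 'rV[R]_3 -> 'rV[R]_3) (p : 'rV[R]_3) :=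
  \forall e \near 0^'+, exists H : R * 'rV[R]_3 -> 'rV[R]_3,
    [/\ {within [set z | 0 <= z.1 <= 1 /\ `|z.2| = 1], continuous H},
        forall u, `|u| = 1 -> H (0, u) = f (p + e *: u) - f p,
        forall u, `|u| = 1 -> H (1, u) = u
      & forall t u, 0 <= t <= 1 -> `|u| = 1 -> H (t, u) != 0].

Definition half_space : set 'rV[R]_3 := [set y | 0 <= y ord0 ord0].

Section Charts.
Variable M : topologicalType.

Record chart := Chart { chart_dom : set M; chart_map :> M -> 'rV[R]_3 }.

(* phi restricts to a homeomorphism from its (open) domain onto a relatively
   open subset of the half-space. *)
Definition is_chart (phi : chart) : Prop :=
  [/\ open (chart_dom phi),
      set_inj (chart_dom phi) phi
    & forall A : set M, A `<=` chart_dom phi ->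
        (open A <-> exists2 V, open V & phi @` A = half_space `&` V)].

Definition boundary : set M :=
  [set x | exists phi, [/\ is_chart phi, chart_dom phi x
                         & phi x ord0 ord0 = 0]].

Definition is_3manifold : Prop :=
  hausdorff_space M /\ forall x, exists2 phi, is_chart phi & chart_dom phi x.

(* Every f that represents the change of charts psi \o phi^-1 preserves the
   orientation at the interior points. *)
Definition compatibly_oriented (phi psi : chart) : Prop :=
  forall f : 'rV[R]_3 -> 'rV[R]_3,
    (forall x, chart_dom phi x -> chart_dom psi x -> f (phi x) = psi x) ->
    forall x, chart_dom phi x -> chart_dom psi x -> 0 < phi x ord0 ord0 ->
      preserves_orientation_at f (phi x).

Definition oriented_atlas (atlas : set chart) : Prop :=
  [/\ atlas `<=` is_chart,
      forall x, exists2 phi, atlas phi & chart_dom phi x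
    & forall phi psi, atlas phi -> atlas psi -> compatibly_oriented phi psi].

Definition compact_connected_oriented_3manifold (atlas : set chart) : Prop :=
  [/\ is_3manifold, compact [set: M], connected [set: M], boundary !=set0
    & oriented_atlas atlas].

(* q : M -> Mhat is the quotient map that collapses each component of the
   boundary to a point. *)
Definition collapses_boundary (Mhat : topologicalType) (q : M -> Mhat) : Prop :=
  [/\ forall y, exists x, q x = y,
      forall A : set Mhat, open A <-> open (q @^-1` A)
    & forall x y, q x = q y <-> x = y \/ connected_component boundary x y].

End Charts.
End Manifolds.

(* The face of the simplex k opposite to the vertex i is glued to the face of
   nbr k i opposite to gperm k i i.  The affine homeomorphism maps each vertex
   j <> i of the first face to the vertex gperm k i j of the second one. *)
Record gluing (K : finType) := Gluing {
  nbr : K -> 'I_4 -> K;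
  gperm : K -> 'I_4 -> 'S_4;
  nbrK : forall k i, nbr (nbr k i) (gperm k i i) = k;
  gpermK : forall k i, gperm (nbr k i) (gperm k i i) = (gperm k i)^-1%g;
  nbr_neq : forall k i, (nbr k i, gperm k i i) != (k, i)
}.

Section Cells.
Variables (K : finType) (G : gluing K).

Definition vstep (x y : K * 'I_4) : bool :=
  [exists i : 'I_4, (i != x.2) && (y == (nbr G x.1 i, gperm G x.1 i x.2))].

Definition vclass (x : K * 'I_4) : {set K * 'I_4} :=
  [set y | connect vstep x y]%SET.

Definition cell0 : finType :=
  {A : {set K * 'I_4} | A \in [set vclass x | x : K * 'I_4]%SET}.

Definition cell0_of (x : K * 'I_4) : cell0 :=
  exist _ (vclass x) (imset_f vclass (isT : x \in predT)).

(* (k, (a, b)) is the edge of the simplex k oriented from a to b. *)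
Definition oedge : finType :=
  {e : K * ('I_4 * 'I_4) | e.2.1 != e.2.2}.

Definition edge (k : K) (a b : 'I_4) (ab : a != b) : oedge :=
  exist (fun e : K * ('I_4 * 'I_4) => e.2.1 != e.2.2) (k, (a, b)) ab.

Definition tail (e : oedge) : K * 'I_4 := ((val e).1, (val e).2.1).
Definition head (e : oedge) : K * 'I_4 := ((val e).1, (val e).2.2).

Lemma head_neq_tail (e : oedge) : (val e).2.2 != (val e).2.1.
Proof. by rewrite eq_sym (valP e). Qed.

Definition rev_edge (e : oedge) : oedge := edge (val e).1 (head_neq_tail e).

Definition estep (e e' : oedge) : bool :=
  [exists i : 'I_4, [&& i != (tail e).2, i != (head e).2,
    tail e' == (nbr G (tail e).1 i, gperm G (tail e).1 i (tail e).2) &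
    head e' == (nbr G (head e).1 i, gperm G (head e).1 i (head e).2)]].

(* e ~ e': identified in Mhat as oriented edges. *)
Definition eident : rel oedge := connect estep.

Definition eclass (e : oedge) : {set oedge} :=
  [set e' | eident e e' || eident (rev_edge e) e']%SET.

Definition cell1 : finType :=
  {A : {set oedge} | A \in [set eclass e | e : oedge]%SET}.

Definition oriented_representatives (rep : cell1 -> oedge) : Prop :=
  forall eps, rep eps \in val eps.

End Cells.

Arguments edge {K} k a b ab.

Section Triangulations.
Variables (R : realType) (K : finType) (G : gluing K).

(* Barycentric coordinates; the vertex i is delta_mx 0 i. *)
Definition simplex : set 'rV[R]_4 :=
  [set x | (forall i, 0 <= x ord0 i) /\ \sum_i x ord0 i = 1].

Definition glue_step (p p' : K * 'rV[R]_4) : Prop :=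
  exists i : 'I_4, [/\ p.2 ord0 i = 0, p'.1 = nbr G p.1 i
    & forall j, p'.2 ord0 (gperm G p.1 i j) = p.2 ord0 j].

(* The maps pi k from the standard simplex identify Mhat with the quotient of
   the disjoint union of the simplices by the gluing; the 0-cells are the
   points of Mhat to which the boundary components are collapsed. *)
Definition ideal_triangulation (M Mhat : topologicalType) (q : M -> Mhat)
    (pi : K -> 'rV[R]_4 -> Mhat) : Prop :=
  [/\ forall y, exists k, exists2 x, simplex x & pi k x = y,
      forall A : set Mhat, open A <->
        forall k, open (pi k @^-1` A : set (subspace simplex)),
      forall k k' x x', simplex x -> simplex x' ->
        (pi k x = pi k' x' <->
         clos_refl_sym_trans _ glue_step (k, x) (k', x'))
    & [set y | exists k i, y = pi k (delta_mx ord0 i)] = q @` @boundary R M].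

(* The chart of the standard simplex with origin the vertex 0 and axes
   the edges 01, 02, 03. *)
Definition simplex_chart (y : 'rV[R]_3) : 'rV[R]_4 :=
  row_mx (1 - \sum_j y ord0 j)%:M y.

Definition open_simplex : set 'rV[R]_3 :=
  [set y | (forall j, 0 < y ord0 j) /\ \sum_j y ord0 j < 1].

Definition oriented_triangulation (M Mhat : topologicalType)
    (atlas : set (chart R M)) (q : M -> Mhat)
    (pi : K -> 'rV[R]_4 -> Mhat) : Prop :=
  forall k phi, atlas phi ->
  forall f : 'rV[R]_3 -> 'rV[R]_3,
    (forall y m, open_simplex y -> chart_dom phi m ->
       q m = pi k (simplex_chart y) -> f y = phi m) ->
    forall y m, open_simplex y -> chart_dom phi m ->
      q m = pi k (simplex_chart y) -> preserves_orientation_at f y.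

End Triangulations.

Section Varieties.
Variable R : realType.

(* An affine variety, as its set of points with its coordinate ring, a ring of
   functions on the points. *)
Record variety := Variety {
  point :> Type;
  regular : set (point -> R[i])
}.

Definition morphism (X Y : variety) (phi : X -> Y) : Prop :=
  forall g, regular (v := Y) g -> regular (v := X) (g \o phi).

Definition isomorphism (X Y : variety) (phi : X -> Y) : Prop :=
  morphism phi /\
  exists psi : Y -> X, [/\ morphism psi, cancel phi psi & cancel psi phi].

Section Spectrum.
Variables (T : Type) (A : set (T -> R[i])).

(* C-algebra homomorphisms from A to C. *)
Definition character (chi : {f | A f} -> R[i]) : Prop :=
  [/\ forall a f, (forall t, sval f t = a) -> chi f = a,
      forall f g h, (forall t, sval h t = sval f t + sval g t) ->
        chi h = chi f + chi g
    & forall f g h, (forall t, sval h t = sval f t * sval g t) ->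
        chi h = chi f * chi g].

(* The affine variety with coordinate ring the C-algebra A: its points are the
   maximal ideals of A, given as kernels of the characters. *)
Definition spectrum : variety :=
  @Variety {chi | character chi}
    [set g | exists a : {f | A f}, forall chi, g chi = sval chi a].

Lemma evaluation_character (t : T) :
  character (fun f : {f | A f} => sval f t).
Proof. by split=> [a f ->|f g h ->|f g h ->]. Qed.

Definition evaluation (t : T) : spectrum :=
  exist _ _ (evaluation_character t).

End Spectrum.

Section Ptolemy.
Variables (K : finType) (G : gluing K).

(* sigma k i is the value on the face of the simplex k opposite to i. *)
Definition face_sign (sigma : K -> 'I_4 -> 'Z_2) k i : R[i] :=
  (-1) ^+ sigma k i.

Definition cocycle (sigma : K -> 'I_4 -> 'Z_2) : Prop :=
  (forall k i, sigma (nbr G k i) (gperm G k i i) = sigma k i) /\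
  (forall k, \prod_(i < 4) face_sign sigma k i = 1).

Notation assignment := {ffun oedge K -> R[i]}.

Definition ptolemy (sigma : K -> 'I_4 -> 'Z_2) : set assignment :=
  [set c | [/\ forall e, c e != 0,
               forall e, c e = - c (rev_edge e),
               forall e e', eident G e e' -> c e = c e'
             & forall k, let s := face_sign sigma k in
    s 0 * s 3 * c (edge k 0 3 isT) * c (edge k 1 2 isT)
    + s 0 * s 1 * c (edge k 0 1 isT) * c (edge k 2 3 isT)
    = s 0 * s 2 * c (edge k 0 2 isT) * c (edge k 1 3 isT)]].

(* Laurent polynomials in the coordinates c_eps, as lists of terms. *)
Definition laurent_eval (p : seq (R[i] * {ffun cell1 G -> int}))
    (z : cell1 G -> R[i]) : R[i] :=
  \sum_(m <- p) m.1 * \prod_(eps : cell1 G) z eps ^ m.2 eps.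

Variable rep : cell1 G -> oedge K.

Definition coord (c : assignment) (eps : cell1 G) : R[i] := c (rep eps).

(* A subset of (C^* )^e with its ring of regular functions. *)
Definition subvariety (X : set assignment) : variety :=
  @Variety {c | X c}
    [set f | exists p, forall c, f c = laurent_eval p (coord (sval c))].

Definition torus : set {ffun cell0 G -> R[i]} :=
  [set x | forall j, x j != 0].

Definition torus_act (x : {ffun cell0 G -> R[i]}) (c : assignment) :
    assignment :=
  [ffun e => x (cell0_of G (tail e)) * x (cell0_of G (head e)) * c e].

Definition invariants (X : set assignment) : set ({c | X c} -> R[i]) :=
  [set f | regular (v := subvariety X) f /\
     forall x, torus x -> forall c c' : {c | X c},
       sval c' = torus_act x (sval c) -> f c' = f c].

Definition ptolemy_variety sigma : variety := subvariety (ptolemy sigma).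

Definition reduced_ptolemy_variety sigma : variety :=
  spectrum (invariants (X := ptolemy sigma)).

Definition quotient_map sigma :
    ptolemy_variety sigma -> reduced_ptolemy_variety sigma :=
  fun c => evaluation (invariants (X := ptolemy sigma)) c.

Section Slice.
Variables (sigma : K -> 'I_4 -> 'Z_2) (n : nat) (eps : 'I_n -> cell1 G).

Definition slice : set assignment :=
  ptolemy sigma `&` [set c | forall i, coord c (eps i) = 1].

Definition slice_variety : variety := subvariety slice.

Definition slice_inclusion (c : slice_variety) : ptolemy_variety sigma :=
  exist _ (sval c) (proj1 (svalP c)).

End Slice.
End Ptolemy.
End Varieties.

(* Main.v *)
Require Import Defs.
From HB Require Import structures.
From Stdlib Require Import Relation_Operators.
From mathcomp Require Import all_boot all_order all_algebra all_fingroup.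
From mathcomp Require Import boolp classical_sets functions reals topology.
From mathcomp Require Import normedtype complex.
From mathcomp Require Import ring.

(** The torus element x multiplies the coordinate of a 1-cell with ends u, w by
    x u * x w.  Imposing that v chosen coordinates equal 1 therefore amounts to
    solving, for each c, the v equations x u * x w * c e = 1 in the v unknowns
    x u.  Choose as 1-cells the edges of a connected spanning subgraph of the
    1-skeleton that has v edges and is not bipartite: a spanning tree together
    with one edge whose ends have the same colour in the 2-colouring of the
    tree.  Along the tree, every unknown is a Laurent monomial in the c e times
    (x r)^{1 or -1}, where r is the root and the exponent depends on the colour;
    the extra edge then gives (x r)^2 as a Laurent monomial.  Hence the system
    has solutions, unique up to a common sign, and every product x u * x w is a
    Laurent monomial in the c e ([odd_spanning_subgraph]).  The sign acts
    trivially, so each torus orbit meets the slice in one point, its normal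
    form, whose coordinates are monomials in those of the given point
    ([normal_form_monomial]).

    The inverse isomorphism comes from pulling back Laurent polynomials along
    the normal form.  This map is onto the ring of invariants, because an
    invariant takes the same value at a point and at its normal form.  So a
    character of the ring of invariants is determined by a character of the
    Laurent polynomial ring, which is the evaluation at a point z without zero
    coordinates ([laurent_character_eval]).  All Laurent relations that hold
    on the slice hold at z, so z lies in the slice ([ptolemy_of_coords],
    [slice_isomorphism]).

    Such a subgraph exists because the 1-skeleton is connected and not
    bipartite.  Every simplex contains a triangle of edges, which rules out
    2-colourings ([skeleton_not_bipartite]).  If the simplices fell into two
    classes not glued to each other, then the images of the classes would be
    disjoint nonempty open sets that cover the quotient of the connected space M
    ([gluing_connected], [skeleton_connected]). *)

Set Implicit Arguments.
Unset Strict Implicit.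
Unset Printing Implicit Defensive.
Import Order.TTheory GRing.Theory Num.Theory.

Import Defs.
Local Open Scope classical_set_scope.
Local Open Scope ring_scope.

(** * Laurent monomials *)

Section Monomials.
Variables (C : fieldType) (E : finType).
Implicit Types (z : E -> C) (k l : {ffun E -> int}).

Definition monomial k z : C := \prod_e z e ^ k e.

Definition unit_exponent (e : E) : {ffun E -> int} := [ffun e' => (e' == e)%:R].

Lemma monomial0 z : monomial 0 z = 1.
Proof. by apply: big1 => e _; rewrite ffunE expr0z. Qed.

Lemma monomial_unit e z : monomial (unit_exponent e) z = z e.
Proof.
rewrite /monomial (bigD1 e) //= ffunE eqxx expr1z big1 ?mulr1 // => e' ne.
by rewrite ffunE (negPf ne) expr0z.
Qed.

Lemma monomialN k z : monomial (- k) z = (monomial k z)^-1.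
Proof.
rewrite /monomial -prodfV; apply: eq_bigr => e _.
by rewrite ffunE -exprz_inv exprz_inv invr_expz.
Qed.

Lemma monomialD k l z : (forall e, z e != 0) ->
  monomial (k + l) z = monomial k z * monomial l z.
Proof.
move=> z0; rewrite /monomial -big_split; apply: eq_bigr => e _ /=.
by rewrite ffunE expfzDr.
Qed.

Lemma monomial_sum I (r : seq I) (f : I -> {ffun E -> int}) z :
  (forall e, z e != 0) ->
  monomial (\sum_(i <- r) f i) z = \prod_(i <- r) monomial (f i) z.
Proof.
move=> z0; elim/big_rec2: _ => [|i y1 y2 _ <-]; first exact: monomial0.
exact: monomialD.
Qed.

Lemma monomialMz k (n : int) z : monomial (k *~ n) z = monomial k z ^ n.
Proof.
rewrite /monomial.
have -> := big_morph (fun y : C => y ^ n) (fun a b => expfzMl a b n) (exp1rz _ n).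
apply: eq_bigr => e _; rewrite exprz_exp; congr (_ ^ _).
by rewrite ffunMzE -mulrzr intz.
Qed.

Lemma monomial_comp (a : E -> {ffun E -> int}) k z : (forall e, z e != 0) ->
  monomial k (fun e => monomial (a e) z) = monomial (\sum_e a e *~ k e) z.
Proof.
by move=> z0; rewrite monomial_sum //; apply: eq_bigr => e _; rewrite monomialMz.
Qed.

(** The group of exponents is free on the unit exponents, so a homomorphism to the
    multiplicative group is determined by its values on them. *)
Lemma multiplicative_monomial (f : {ffun E -> int} -> C) :
    f 0 = 1 -> (forall k l, f (k + l) = f k * f l) ->
  forall k, f k = monomial k (fun e => f (unit_exponent e)).
Proof.
move=> f0 fD k.
have fN l : f (- l) = (f l)^-1.
  by apply/esym/mulr1_eq; rewrite -fD subrr.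
have fn l (n : nat) : f (l *+ n) = f l ^+ n.
  elim: n => [|n IH]; first by rewrite mulr0n f0 expr0.
  by rewrite mulrS fD IH exprS.
have fz l (n : int) : f (l *~ n) = f l ^ n.
  by case: n => n; [exact: fn | rewrite NegzE mulrNz fN -exprnN -pmulrn fn].
transitivity (f (\sum_e unit_exponent e *~ k e)).
  congr f; apply/ffunP => e; rewrite sum_ffunE (bigD1 e) //= ffunMzE ffunE eqxx.
  rewrite intz big1 ?addr0 // => e' ne.
  by rewrite ffunMzE ffunE eq_sym (negPf ne) mul0rz.
rewrite (big_morph f fD f0).
by apply: eq_bigr => e _; exact: fz.
Qed.
End Monomials.

(** * Odd spanning subgraphs *)

Section Graphs.
Variables (C : numClosedFieldType) (V E : finType) (s t : E -> V).
Implicit Types (c : E -> C) (x : V -> C) (F : seq E) (S : {set V}) (col : V -> bool).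

Definition nonvanishing (I : Type) (f : I -> C) := forall i, f i != 0.

(** The system for the torus element x that moves the coordinates of c along F
    to 1. *)
Definition normalizes c F x :=
  forall e, e \in F -> x (s e) * x (t e) * c e = 1.

Definition invert_if (b : bool) (y : C) := if b then y^-1 else y.

(** F is the edge set of a tree on S, 2-coloured by col.  The algebraic consequences
    kept here are what the induction on S needs: the system along F is solvable,
    and a solution is determined by its value at the root r up to Laurent monomials,
    the value at u being proportional to x r or to its inverse according to the
    colour of u. *)
Definition bicoloured_tree (r : V) S F col :=
  [/\ uniq F, (size F).+1 = #|S|,
      forall e, e \in F -> [/\ s e \in S, t e \in S & col (s e) != col (t e)],
      forall c, nonvanishing c -> exists2 x, nonvanishing x & normalizes c F x
    & forall u, u \in S -> exists k, forall c x,
        nonvanishing c -> nonvanishing x -> normalizes c F x ->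
        x u = monomial k c * invert_if (col u) (x r)].

Lemma invert_if_neq0 b y : y != 0 -> invert_if b y != 0.
Proof. by case: b; rewrite //= invr_eq0. Qed.

(** A new leaf w adds one unknown and one equation, which determines the unknown:
    x w = (x a * c e)^-1.  The inversion is why the colour changes along the edge. *)
Lemma extend_tree r S F col e a w :
    bicoloured_tree r S F col -> a \in S -> w \notin S ->
    (s e = a /\ t e = w) \/ (s e = w /\ t e = a) ->
  bicoloured_tree r (w |: S) (e :: F) (fun u => if u == w then ~~ col a else col u).
Proof.
move=> [uF cF endF solF monF] aS wS ends.
have aw : a != w by apply: contraNneq wS => <-.
have xe (x : V -> C) : x (s e) * x (t e) = x a * x w.
  by case: ends => -[-> ->] //; rewrite mulrC.
have Sw u : u \in S -> (u == w) = false by move=> uS; apply: contraNF wS => /eqP <-.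
split.
- rewrite /= uF andbT; apply: contra wS => /endF[].
  by case: ends => -[se te]; rewrite ?se ?te.
- by rewrite cardsU1 wS /= cF.
- move=> f; rewrite inE => /predU1P[->|/endF[fs ft fc]].
    case: ends => -[-> ->]; rewrite !inE eqxx aS orbT (negPf aw).
      by split=> //; case: (col a).
    by split=> //; case: (col a).
  by rewrite !inE fs ft !orbT !Sw.
- move=> c c0; have [x x0 xF] := solF c c0.
  exists (fun u => if u == w then (x a * c e)^-1 else x u).
    by move=> u; case: ifP => // _; rewrite invr_eq0 mulf_neq0.
  move=> f; rewrite inE => /predU1P[->|fF].
    rewrite (xe (fun u => if u == w then (x a * c e)^-1 else x u)) eqxx (negPf aw).
    by rewrite mulrAC mulfV // mulf_neq0.
  by have [fs ft _] := endF f fF; rewrite !Sw ?xF.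
- move=> u; rewrite !inE => /predU1P[->|uS].
    have [k kP] := monF a aS; exists (- k - unit_exponent e) => c x c0 x0 xF.
    have xa := kP c x c0 x0 (fun f fF => xF f (@mem_behead _ (e :: F) f fF)).
    have := xF e (mem_head _ _); rewrite xe => xw.
    rewrite eqxx -opprD monomialN monomialD // monomial_unit.
    have -> : invert_if (~~ col a) (x r) = (invert_if (col a) (x r))^-1.
      by case: (col a) => //=; rewrite invrK.
    rewrite -invfM mulrAC -xa; apply/esym/mulr1_eq.
    by rewrite -xw mulrAC.
  have [k kP] := monF u uS; exists k => c x c0 x0 xF; rewrite Sw //.
  by apply: kP => // f fF; apply: xF; rewrite inE fF orbT.
Qed.

Hypothesis connected_graph :
  forall S, S != finset.set0 -> S != [set: V]%SET -> exists e, (s e \in S) != (t e \in S).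

Lemma exists_spanning_tree (r : V) : exists F col, bicoloured_tree r [set: V]%SET F col.
Proof.
suff grow n : (n < #|V|)%N -> exists S F col,
    #|S| = n.+1 /\ bicoloured_tree r S F col.
  have V0 : (0 < #|V|)%N by apply/card_gt0P; exists r.
  have [|S [F [col [cS tS]]]] := grow #|V|.-1; first by rewrite prednK.
  suff ->: [set: V]%SET = S by exists F, col.
  by apply/esym/eqP; rewrite eqEcard finset.subsetT finset.cardsT cS prednK /=.
elim: n => [|n IH] nV.
  exists [set r]%SET, [::], xpred0; rewrite cards1; split=> //; split => //=.
  - by rewrite cards1.
  - by move=> c _; exists (fun=> 1) => // _; apply: oner_neq0.
  - move=> u /set1P ->; exists 0 => c x _ _ _; by rewrite monomial0 mul1r.
have [S [F [col [cS tS]]]] := IH (ltnW nV).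
have [||e eS] := @connected_graph S; first by rewrite -card_gt0 cS.
  by apply: contraTneq nV => SE; rewrite -leqNgt -cS SE cardsT.
have [a [w [aS wS ends]]] : exists a w, [/\ a \in S, w \notin S &
    (s e = a /\ t e = w) \/ (s e = w /\ t e = a)].
  move: eS; case sS: (s e \in S); case tS': (t e \in S) => // _.
    by exists (s e), (t e); rewrite tS'; split => //; left.
  by exists (t e), (s e); rewrite sS; split => //; right.
exists (w |: S)%SET, (e :: F), (fun u => if u == w then ~~ col a else col u).
by rewrite cardsU1 wS cS; split=> //; apply: extend_tree ends.
Qed.

Hypothesis not_bipartite : forall col, exists e, col (s e) = col (t e).

(** The subgraph is a spanning tree plus an edge with ends of equal colour.  Given a
    solution x of the tree equations, so is x u * tau^{1 or -1}, with the sign given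
    by the colour; the extra equation fixes tau ^+ 2.  The product x u * x w involves
    only even powers of x r, and the extra equation makes these monomials. *)
Theorem odd_spanning_subgraph (r : V) : exists eps : 'I_#|V| -> E,
  [/\ injective eps,
      forall c, nonvanishing c ->
        exists2 x, nonvanishing x & normalizes c (codom eps) x
    & forall u w, exists k, forall c x, nonvanishing c -> nonvanishing x ->
        normalizes c (codom eps) x -> x u * x w = monomial k c].
Proof.
have [F [col [uF cF endF solF monF]]] := exists_spanning_tree r.
have [e0 e0P] := not_bipartite col.
have sz : size (e0 :: F) = #|V| by rewrite /= cF cardsT.
have e0F : e0 \notin F by apply/negP => /endF[_ _]; rewrite e0P eqxx.
pose eps (i : 'I_#|V|) := nth e0 (e0 :: F) i.
have epsE : codom eps =i e0 :: F.
  move=> e; apply/codomP/idP => [[i ->]|/(nthP e0)[j]].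
    by rewrite mem_nth // sz.
  rewrite sz => jV <-; by exists (Ordinal jV).
have normE c x : normalizes c (codom eps) x <-> normalizes c (e0 :: F) x.
  by split=> H e; have := H e; rewrite epsE.
exists eps; split.
- move=> i j /eqP; rewrite nth_uniq ?sz //= ?e0F // => /eqP.
  exact: val_inj.
- move=> c c0; have [x x0 xF] := solF c c0.
  set y := x (s e0) * x (t e0) * c e0.
  have y0 : y != 0 by rewrite !mulf_neq0.
  (* Scaling by tau multiplies y by tau ^+ 2 if the ends of e0 have colour false,
     and by tau ^- 2 otherwise. *)
  pose tau := sqrtC (invert_if (~~ col (s e0)) y).
  have tau0 : tau != 0 by rewrite sqrtC_eq0 invert_if_neq0.
  exists (fun u => x u * invert_if (col u) tau) => [u|].
    by rewrite mulf_neq0 ?invert_if_neq0.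
  apply/normE => e; rewrite inE => /predU1P[->|eF].
    have -> : forall b d, x (s e0) * b * (x (t e0) * d) * c e0 = y * (b * d).
      by move=> b d; rewrite /y; ring.
    rewrite -e0P -expr2.
    have tau2 := sqrtCK (invert_if (~~ col (s e0)) y); rewrite -/tau in tau2.
    by case: (col (s e0)) tau2 => /= tau2; rewrite ?exprVn tau2 mulfV.
  have [_ _ ce] := endF e eF; have xe := xF e eF.
  have -> : forall b d, x (s e) * b * (x (t e) * d) * c e =
     x (s e) * x (t e) * c e * (b * d).
    by move=> b d; ring.
  rewrite xe mul1r.
  by case: (col (s e)) (col (t e)) ce => -[] //= _; rewrite ?mulfV ?mulVf.
have [k1 k1P] := monF (s e0) (finset.in_setT _); have [k2 k2P] := monF (t e0) (finset.in_setT _).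
(* The exponent of the monomial (x r) ^+ 2. *)
pose kr := if col (s e0) then k1 + k2 + unit_exponent e0
           else - (k1 + k2 + unit_exponent e0).
have krP c x : nonvanishing c -> nonvanishing x -> normalizes c (e0 :: F) x ->
    x r * x r = monomial kr c.
  move=> c0 x0 xF; have xF' : normalizes c F x by move=> e eF; apply: xF; rewrite inE eF orbT.
  have := xF e0 (mem_head _ _); rewrite (k1P c x) // (k2P c x) // -e0P.
  have -> : forall m1 m2 d g : C, m1 * d * (m2 * d) * g = m1 * m2 * g * (d * d).
    by move=> *; ring.
  rewrite /kr -(monomial_unit e0 c) -!monomialD //.
  case: (col (s e0)) => /= /mulr1_eq mE; last by rewrite monomialN mE.
  by rewrite -[RHS]invrK mE -invfM invrK.
move=> u w; have [ku kuP] := monF u (finset.in_setT _); have [kw kwP] := monF w (finset.in_setT _).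
exists (ku + kw + (if col u == col w then if col u then - kr else kr else 0)).
move=> c x c0 x0 /normE xF; have xF' : normalizes c F x by move=> e eF; apply: xF; rewrite inE eF orbT.
rewrite (kuP c x) // (kwP c x) // !monomialD // mulrACA; congr (_ * _).
case: (col u) (col w) => -[]; rewrite /= ?monomialN ?monomial0 -?(krP c x) //.
- by rewrite invfM.
- by rewrite mulVf.
- by rewrite mulfV.
Qed.
End Graphs.

(** * Cells of a gluing *)

Section Cells.
Variables (K : finType) (G : gluing K).

(** The gluing of a face is undone by the gluing of the face that it is glued to. *)
Lemma vstep_sym : symmetric (vstep G).
Proof.
suff imp x y : vstep G x y -> vstep G y x by move=> x y; apply/idP/idP; exact: imp.
case/existsP=> i /andP[ix /eqP ->]; apply/existsP; exists (gperm G x.1 i i) => /=.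
rewrite (inj_eq perm_inj) ix /= nbrK gpermK permK; apply/eqP; exact: surjective_pairing.
Qed.

Lemma cell0_of_step x y : vstep G x y -> cell0_of G x = cell0_of G y.
Proof.
move=> xy; apply: val_inj => /=; apply/setP => z; rewrite !inE.
have csym : connect_sym (vstep G) := sym_connect_sym vstep_sym.
exact: (same_connect csym (connect1 xy)).
Qed.

Lemma cell0_of_eident e e' : eident G e e' ->
  cell0_of G (tail e) = cell0_of G (tail e') /\
  cell0_of G (head e) = cell0_of G (head e').
Proof.
case/connectP => p; elim: p e => [|f p IH] e /=; first by move=> _ ->.
case/andP=> /existsP[j /and4P[jt jh /eqP te /eqP he]] pf e'E.
have [<- <-] := IH f pf e'E; split; apply: cell0_of_step; apply/existsP; exists j.
  by rewrite te eqxx jt.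
by rewrite he eqxx jh.
Qed.

Definition cell1_of (e : oedge K) : cell1 G :=
  exist _ (eclass G e) (imset_f (eclass G) (isT : e \in predT)).

Variable rep : cell1 G -> oedge K.
Hypothesis repP : oriented_representatives rep.

Definition start (eps : cell1 G) := cell0_of G (tail (rep eps)).
Definition finish (eps : cell1 G) := cell0_of G (head (rep eps)).

Lemma rep_cell1_of e :
  eident G e (rep (cell1_of e)) \/ eident G (rev_edge e) (rep (cell1_of e)).
Proof. by have := repP (cell1_of e); rewrite inE => /orP. Qed.

(** The chosen representative of the 1-cell of e may be e or its reverse up to
    identification, hence the two cases. *)
Lemma ends_cell1_of e :
  [\/ cell0_of G (tail e) = start (cell1_of e) /\
      cell0_of G (head e) = finish (cell1_of e)
    | cell0_of G (tail e) = finish (cell1_of e) /\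
      cell0_of G (head e) = start (cell1_of e)].
Proof.
case: (rep_cell1_of e) => /cell0_of_eident[te he]; first by left.
by right; split.
Qed.
End Cells.

(** * Laurent polynomials and their characters *)

Section Laurent.
Variables (R : realType) (K : finType) (G : gluing K).
Implicit Types (z : cell1 G -> R[i]) (f g : (cell1 G -> R[i]) -> R[i]).
Implicit Types (p q : seq (R[i] * {ffun cell1 G -> int})).

(** Equality is only asked where no coordinate vanishes: elsewhere the inverse of 0
    is 0, and evaluation is not multiplicative. *)
Definition is_laurent f :=
  exists p, forall z, nonvanishing z -> f z = laurent_eval p z.

Lemma laurent_eval_term a k z : laurent_eval [:: (a, k)] z = a * monomial k z.
Proof. by rewrite /laurent_eval big_seq1. Qed.

Lemma laurent_eval_cons m p z :
  laurent_eval (m :: p) z = laurent_eval [:: m] z + laurent_eval p z.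
Proof. by rewrite /laurent_eval big_cons big_seq1. Qed.

Lemma is_laurent_const a : is_laurent (fun=> a).
Proof. by exists [:: (a, 0)] => z _; rewrite laurent_eval_term monomial0 mulr1. Qed.

Lemma is_laurent_coord e : is_laurent (fun z => z e).
Proof.
by exists [:: (1, unit_exponent e)] => z _; rewrite laurent_eval_term monomial_unit mul1r.
Qed.

Lemma is_laurentD f g : is_laurent f -> is_laurent g -> is_laurent (fun z => f z + g z).
Proof.
move=> [p pP] [q qP]; exists (p ++ q) => z z0.
by rewrite pP // qP // /laurent_eval big_cat.
Qed.

Lemma is_laurentM f g : is_laurent f -> is_laurent g -> is_laurent (fun z => f z * g z).
Proof.
move=> [p pP] [q qP]; exists [seq (m.1 * l.1, m.2 + l.2) | m <- p, l <- q] => z z0.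
rewrite pP // qP // /laurent_eval big_allpairs_dep mulr_suml; apply: eq_bigr => m _.
rewrite mulr_sumr; apply: eq_bigr => l _ /=.
by rewrite -!/(monomial _ z) monomialD // mulrACA.
Qed.

Lemma laurent_eval_comp (a : cell1 G -> {ffun cell1 G -> int}) p :
  is_laurent (fun z => laurent_eval p (fun e => monomial (a e) z)).
Proof.
pose subst (m : R[i] * {ffun cell1 G -> int}) := (m.1, \sum_e a e *~ m.2 e).
exists [seq subst m | m <- p] => z z0.
rewrite /laurent_eval big_map; apply: eq_bigr => m _ /=.
by rewrite -!/(monomial _ _) monomial_comp.
Qed.

(** A C-algebra homomorphism from the Laurent polynomials to C is the evaluation at
    a point of the torus.  It is presented on lists of terms, so its compatibility
    with the operations is stated through the functions that the lists represent.
    The coordinates of the point are the images of the variables, which are units. *)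
Lemma laurent_character_eval (chi : seq (R[i] * {ffun cell1 G -> int}) -> R[i]) :
    (forall p q, (forall z, nonvanishing z -> laurent_eval p z = laurent_eval q z) ->
       chi p = chi q) ->
    (forall p q l,
       (forall z, nonvanishing z -> laurent_eval l z = laurent_eval p z + laurent_eval q z) ->
       chi l = chi p + chi q) ->
    (forall p q l,
       (forall z, nonvanishing z -> laurent_eval l z = laurent_eval p z * laurent_eval q z) ->
       chi l = chi p * chi q) ->
    (forall a, chi [:: (a, 0)] = a) ->
  exists2 z, nonvanishing z & forall p, chi p = laurent_eval p z.
Proof.
move=> chi_ext chiD chiM chiC.
have chiMD k l : chi [:: (1, k + l)] = chi [:: (1, k)] * chi [:: (1, l)].
  by apply: chiM => z z0; rewrite !laurent_eval_term monomialD // !mul1r.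
exists (fun e => chi [:: (1, unit_exponent e)]).
  move=> e; apply/eqP => ch0; move: (chiC 1).
  have -> : (0 : {ffun cell1 G -> int}) = unit_exponent e - unit_exponent e.
    by rewrite subrr.
  by rewrite chiMD ch0 mul0r => /eqP; rewrite eq_sym oner_eq0.
elim=> [|m p IH].
  rewrite /laurent_eval big_nil -(chiC 0); apply: chi_ext => z _.
  by rewrite laurent_eval_term mul0r /laurent_eval big_nil.
rewrite (chiD [:: m] p) => [|z _]; last exact: laurent_eval_cons.
rewrite laurent_eval_cons IH; congr (_ + _); case: m => a k.
rewrite (chiM [:: (a, 0)] [:: (1, k)]) => [|z _]; last first.
  by rewrite !laurent_eval_term monomial0 mulr1 mul1r.
rewrite chiC laurent_eval_term; congr (_ * _).
exact: (multiplicative_monomial (f := fun k => chi [:: (1, k)])).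
Qed.
End Laurent.

(** * Ptolemy assignments and the torus action *)

Section Ptolemy.
Variables (R : realType) (K : finType) (G : gluing K).
Variables (sigma : K -> 'I_4 -> 'Z_2) (rep : cell1 G -> oedge K).
Hypothesis repP : oriented_representatives rep.
Notation assignment := {ffun oedge K -> R[i]}.
Implicit Types (c : assignment) (x : {ffun cell0 G -> R[i]}).

(** The sign that compares an oriented edge with the chosen representative of its
    1-cell. *)
Definition edge_sign (e : oedge K) : R[i] :=
  if eident G e (rep (cell1_of G e)) then 1 else -1.

Lemma ptolemy_coord c e : ptolemy G sigma c ->
  c e = edge_sign e * coord rep c (cell1_of G e).
Proof.
move=> [_ cN cE _]; rewrite /edge_sign /coord; case: ifP => [/cE -> |].
  by rewrite mul1r.
case: (rep_cell1_of repP e) => [-> //|/cE ce _].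
by rewrite cN ce mulN1r.
Qed.

Lemma coord_neq0 c : ptolemy G sigma c -> nonvanishing (coord rep c).
Proof. by case=> c0 _ _ _ e; apply: c0. Qed.

Lemma coord_torus_act x c e :
  coord rep (torus_act x c) e =
    x (start rep e) * x (finish rep e) * coord rep c e.
Proof. by rewrite /coord ffunE. Qed.

(** Each of the three terms of a Ptolemy relation involves every vertex of the simplex
    once, so the torus element multiplies all of them by the same factor. *)
Lemma ptolemy_torus_act x c :
  torus x -> ptolemy G sigma c -> ptolemy G sigma (torus_act x c).
Proof.
move=> x0 [c0 cN cE cP]; split.
- by move=> e; rewrite ffunE !mulf_neq0.
- by move=> e; rewrite !ffunE [c e]cN mulrN [x _ * x _]mulrC.
- by move=> e e' ee; rewrite !ffunE (cE _ _ ee); have [-> ->] := cell0_of_eident ee.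
- move=> k s; rewrite !ffunE /tail /head /=.
  have := cP k; rewrite -/s => cPk.
  set x0' := x (cell0_of G (k, 0)); set x1 := x (cell0_of G (k, 1)).
  set x2 := x (cell0_of G (k, 2)); set x3 := x (cell0_of G (k, 3)).
  transitivity (x0' * x1 * x2 * x3 * (s 0 * s 3 * c (edge k 0 3 isT) * c (edge k 1 2 isT)
    + s 0 * s 1 * c (edge k 0 1 isT) * c (edge k 2 3 isT))); first by ring.
  by rewrite cPk; ring.
Qed.

Lemma torus_actA x y c :
  torus_act x (torus_act y c) = torus_act [ffun j => x j * y j] c.
Proof. by apply/ffunP => e; rewrite !ffunE mulrA; congr (_ * _); exact: mulrACA. Qed.

(** The conditions that define Ptolemy assignments are Laurent equations, so they hold
    at each nonvanishing point z of the Zariski closure of P.  When an edge is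
    identified with its own reverse, P is empty and no such z exists; this is why
    the sign conditions too are deduced from the equations on P. *)
Lemma ptolemy_of_coords (P : set assignment) (z : cell1 G -> R[i]) :
    P `<=` ptolemy G sigma -> nonvanishing z ->
    (forall f g, is_laurent f -> is_laurent g ->
       (forall c, P c -> f (coord rep c) = g (coord rep c)) -> f z = g z) ->
  exists2 c, ptolemy G sigma c & coord rep c =1 z.
Proof.
move=> sP z0 zP.
pose f e (y : cell1 G -> R[i]) := edge_sign e * y (cell1_of G e).
have fL e : is_laurent (f e).
  by apply: is_laurentM; [exact: is_laurent_const | exact: is_laurent_coord].
have fE c e : P c -> f e (coord rep c) = c e.
  by move=> /sP pc; rewrite /f -ptolemy_coord.
exists [ffun e => f e z]; last first.
  move=> e; rewrite /coord ffunE.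
  by apply: (zP _ (fun y => y e) (fL _) (is_laurent_coord _ _)) => c /fE ->.
split.
- move=> e; rewrite ffunE mulf_neq0 // /edge_sign; case: ifP => _.
    exact: oner_neq0.
  by rewrite oppr_eq0 oner_neq0.
- move=> e; rewrite !ffunE -mulN1r.
  apply: (zP _ (fun y => -1 * f (rev_edge e) y) (fL _)).
    by apply: is_laurentM => //; exact: is_laurent_const.
  by move=> c Pc; rewrite !fE // mulN1r; have [_ ->] := sP c Pc.
- move=> e e' ee; rewrite !ffunE; apply: zP => // c Pc.
  by rewrite !fE //; have [_ _ /(_ e e' ee)] := sP c Pc.
- move=> k s; rewrite !ffunE.
  have ffL a e e' : is_laurent (fun y => a * f e y * f e' y).
    by do 2 apply: is_laurentM => //; exact: is_laurent_const.
  apply: (zP (fun y => s 0 * s 3 * f (edge k 0 3 isT) y * f (edge k 1 2 isT) y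
                     + s 0 * s 1 * f (edge k 0 1 isT) y * f (edge k 2 3 isT) y)
             (fun y => s 0 * s 2 * f (edge k 0 2 isT) y * f (edge k 1 3 isT) y)) => //.
    exact: is_laurentD.
  by move=> c Pc; rewrite !fE //; have [_ _ _ /(_ k)] := sP c Pc.
Qed.
End Ptolemy.

(** * The slice as a quotient *)

Lemma sval_inj T (P : T -> Prop) : injective (@sval T P).
Proof. by case=> u Pu [v Pv] /= uv; apply: eq_exist. Qed.

Section Slices.
Variables (R : realType) (K : finType) (G : gluing K).
Variables (sigma : K -> 'I_4 -> 'Z_2) (rep : cell1 G -> oedge K).
Hypothesis repP : oriented_representatives rep.
Variables (n : nat) (eps : 'I_n -> cell1 G).

Notation normalizing := (normalizes (start rep) (finish rep)).

Hypothesis normalizable : forall c : cell1 G -> R[i], nonvanishing c ->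
  exists2 x, nonvanishing x & normalizing c (codom eps) x.
Hypothesis normalizer_monomial : forall u w, exists k,
  forall (c : cell1 G -> R[i]) x, nonvanishing c -> nonvanishing x ->
    normalizing c (codom eps) x -> x u * x w = monomial k c.

Notation X := (@ptolemy R K G sigma).
Notation act := (@torus_act R K G).
Notation S := (@slice R K G rep sigma n eps).
Notation assignment := {ffun oedge K -> R[i]}.
Implicit Types (x : {ffun cell0 G -> R[i]}).

Lemma slice_torus_act x c : X c -> torus x ->
  S (act x c) <-> normalizing (coord rep c) (codom eps) x.
Proof.
move=> Xc x0; split=> [[_ xc] _ /codomP[j ->]|xc].
  by rewrite -coord_torus_act xc.
split; first exact: ptolemy_torus_act.
by move=> j; rewrite /= coord_torus_act xc // codom_f.
Qed.

Lemma orbit_meets_slice c : X c -> exists2 x : {ffun cell0 G -> R[i]}, torus x & S (act x c).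
Proof.
move=> Xc; have [x x0 xc] := normalizable (coord_neq0 rep Xc).
have x'0 : torus (finfun x) by move=> j; rewrite ffunE.
exists (finfun x) => //; apply/slice_torus_act => // e eE.
by rewrite !ffunE xc.
Qed.

(** The system determines the torus element up to a common sign, which acts
    trivially: the action only involves products of two of its coordinates. *)
Lemma orbit_meets_slice_once c x y : X c -> torus x -> torus y ->
  S (act x c) -> S (act y c) -> act x c = act y c.
Proof.
move=> Xc x0 y0 /(slice_torus_act Xc x0) xc /(slice_torus_act Xc y0) yc.
apply/ffunP => e; rewrite !ffunE; congr (_ * _).
have [k kP] := normalizer_monomial (cell0_of G (tail e)) (cell0_of G (head e)).
by rewrite !(kP (coord rep c)) //; apply: coord_neq0 Xc.
Qed.

(** The action multiplies a coordinate by a product of two unknowns of the system,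
    which is a monomial in c.  This makes the normal form a regular map. *)
Lemma normal_form_monomial : exists a : cell1 G -> {ffun cell1 G -> int},
  forall c x e, X c -> torus x -> S (act x c) ->
    coord rep (act x c) e = monomial (a e) (coord rep c).
Proof.
have /choice[a aP] : forall e, exists k, forall c x, X c -> torus x ->
    S (act x c) -> coord rep (act x c) e = monomial k (coord rep c).
  move=> e; have [k kP] := normalizer_monomial (start rep e) (finish rep e).
  exists (k + unit_exponent e) => c x Xc x0 /(slice_torus_act Xc x0) xc.
  have c0 := coord_neq0 rep Xc.
  by rewrite coord_torus_act monomialD // monomial_unit (kP (coord rep c)).
by exists a => c x e; exact: aP.
Qed.

(** The inverse sends a character chi of the ring of invariants to the point c of the
    slice such that chi takes the pullback of each Laurent polynomial p along the
    normal form to the value of p at c. *)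
Theorem slice_isomorphism :
  isomorphism (fun c : slice_variety R rep sigma eps =>
    quotient_map (slice_inclusion c)).
Proof.
have [nx nx0 nS] : exists2 nx : {c | X c} -> {ffun cell0 G -> R[i]},
    forall c : {c | X c}, torus (nx c)
  & forall c : {c | X c}, S (act (nx c) (sval c)).
  have /choice[nx nxP] : forall c : {c | X c}, exists x : {ffun cell0 G -> R[i]}, torus x /\ S (act x (sval c)).
    by move=> [c Xc]; have [x] := orbit_meets_slice Xc; exists x.
  by exists nx => c; have [] := nxP c.
(* The normal form of c, the point of its orbit in the slice. *)
pose nf (c : {c | X c}) : assignment := act (nx c) (sval c).
have nf_inv (c c' : {c | X c}) x : torus x -> sval c' = act x (sval c) -> nf c' = nf c.
  move=> x0 c'E; have := nS c'; rewrite /nf c'E torus_actA => xS.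
  apply: orbit_meets_slice_once => //; first exact: (svalP c).
  by move=> j; rewrite ffunE mulf_neq0 //; apply: nx0.
have nf_id (c : {c | X c}) : S (sval c) -> nf c = sval c.
  have act1 : act ([ffun=> 1] : {ffun cell0 G -> R[i]}) (sval c) = sval c.
    by apply/ffunP => e; rewrite !ffunE !mul1r.
  move=> Sc; rewrite -[RHS]act1.
  apply: orbit_meets_slice_once => //; first exact: (svalP c).
  - by move=> j; rewrite ffunE oner_neq0.
  - by rewrite act1.
have [a aP] := normal_form_monomial.
have nf_coord (c : {c | X c}) : coord rep (nf c) = fun e => monomial (a e) (coord rep (sval c)).
  by apply/funext => e; apply: aP => //; exact: (svalP c).
have Xnf (c : {c | X c}) : X (nf c) by case: (nS c).
have Qinv p : invariants rep (fun c : {c | X c} => laurent_eval p (coord rep (nf c))).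
  split=> [|x x0 c c' c'E]; last by rewrite (nf_inv c c' x).
  have [p' p'P] := laurent_eval_comp a p; exists p' => c.
  by rewrite nf_coord p'P //; apply: coord_neq0 (svalP c).
(* The pullback of p along the normal form. *)
pose Q p : {f | invariants rep (X := X) f} := exist _ _ (Qinv p).
have evalQ (chi : reduced_ptolemy_variety R rep sigma) :
    exists2 c, S c & forall p, sval chi (Q p) = laurent_eval p (coord rep c).
  case: chi => chi [chiC chiD chiM] /=.
  (* Characters are functions of elements of a subtype; the additivity axiom with
     the zero invariant shows that they only depend on the values of the element. *)
  have chi_ext f g : (forall c, sval f c = sval g c) -> chi f = chi g.
    have Q0 c : sval (Q [::]) c = 0 by rewrite /= /laurent_eval big_nil.
    move=> fg; rewrite (chiD (Q [::]) g f) => [|c]; last by rewrite fg Q0 add0r.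
    by rewrite (chiC 0 _ Q0) add0r.
  have nf0 (c : {c | X c}) := coord_neq0 rep (Xnf c).
  have [||||z z0 zP] := @laurent_character_eval R K G (fun p => chi (Q p)).
  - by move=> p q pq; apply: chi_ext => c; apply: pq; exact: nf0.
  - by move=> p q l H; apply: chiD => c; apply: H; exact: nf0.
  - by move=> p q l H; apply: chiM => c; apply: H; exact: nf0.
  - move=> b; apply: chiC => c /=; by rewrite laurent_eval_term monomial0 mulr1.
  have zS f g : is_laurent f -> is_laurent g ->
      (forall c : assignment, S c -> f (coord rep c) = g (coord rep c)) -> f z = g z.
    move=> [p pP] [q qP] fg; rewrite pP // qP // -!zP; apply: chi_ext => c /=.
    by rewrite -pP // -?qP // fg //; exact: nS.
  have [c Xc cz] := ptolemy_of_coords (P := S) (sigma := sigma) repP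
    (fun c Sc => proj1 Sc) z0 zS.
  exists c; last by move=> p; rewrite zP; congr laurent_eval; apply/esym/funext.
  split=> // j /=; rewrite cz.
  apply: (zS (fun y => y (eps j)) (fun=> 1)).
  - exact: is_laurent_coord.
  - exact: is_laurent_const.
  - by move=> d [_ ->].
have {evalQ} /choice[psi psiP] : forall chi : reduced_ptolemy_variety R rep sigma,
    exists c : slice_variety R rep sigma eps,
      forall p, sval chi (Q p) = laurent_eval p (coord rep (sval c)).
  by move=> chi; have [c Sc cP] := evalQ chi; exists (exist _ c Sc).
have coord_inj c c' : X c -> X c' -> coord rep c = coord rep c' -> c = c'.
  by move=> Xc Xc' cc'; apply/ffunP => e; rewrite (ptolemy_coord repP e Xc) (ptolemy_coord repP e Xc') cc'.
have evalE (c : {c | X c}) p : sval (quotient_map (rep := rep) (sigma := sigma) c) (Q p) =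
    laurent_eval p (coord rep (nf c)) by [].
split.
  move=> g [b bP]; have [[p pP] _] := svalP b.
  by exists p => c; rewrite /= bP /= pP.
exists psi; split.
- move=> g [p pP]; exists (Q p) => chi.
  by rewrite /= pP -psiP.
- move=> c; apply: sval_inj; apply: coord_inj; [by case: (svalP (psi (quotient_map (slice_inclusion c))))|by case: (svalP c)|].
  apply/funext => e; have := psiP (quotient_map (slice_inclusion c)) [:: (1, unit_exponent e)].
  rewrite evalE nf_id; last exact: (svalP c).
  by rewrite !laurent_eval_term !mul1r !monomial_unit => ->.
- move=> chi; apply: sval_inj; apply/funext => -[b bI] /=.
  have [[p pP] binv] := bI.
  rewrite pP /= -psiP; congr (sval chi _); apply: sval_inj; apply/funext => c /=.
  by rewrite -(binv (nx c) (nx0 c) c (exist _ (nf c) (Xnf c))) ?pP.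
Qed.
End Slices.

(** * Connectedness of the triangulation *)

Section Connectedness.
Variables (R : realType) (M Mhat : topologicalType) (q : M -> Mhat).
Variables (K : finType) (G : gluing K) (pi : K -> 'rV[R]_4 -> Mhat).
Hypothesis collapse : collapses_boundary R q.
Hypothesis triangulation : ideal_triangulation G q pi.
Hypothesis connectedM : connected [set: M].

Lemma simplex_delta (j : 'I_4) : simplex (delta_mx ord0 j : 'rV[R]_4).
Proof.
split=> [l|]; first by rewrite mxE ler0n.
rewrite (bigD1 j) //= mxE !eqxx big1 ?addr0 // => l lj.
by rewrite mxE (negPf lj) andbF.
Qed.

(** A class of simplices closed under gluing has an open image in the triangulated
    space, since the preimage of this image in each simplex is empty or everything.
    The image of the complementary class is the complement, so the image is also
    closed, and connectedness applies to its preimage in M. *)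
Lemma gluing_connected (side : K -> bool) :
  (forall k j, side (nbr G k j) = side k) -> forall k l, side k = side l.
Proof.
move=> side_nbr.
have [piS pi_open pi_eq _] := triangulation; have [qS q_open _] := collapse.
have side_pi k l x y : simplex x -> simplex y -> pi k x = pi l y -> side k = side l.
  move=> sx sy /(pi_eq k l x y sx sy).
  suff H (a b : K * 'rV[R]_4) : clos_refl_sym_trans _ (glue_step G) a b -> side a.1 = side b.1.
    exact: (H (k, x) (l, y)).
  elim=> {a b} [a b [j [_ -> _]]|//|a b _ -> //|a b d _ -> _ -> //].
  by rewrite side_nbr.
pose A b := [set y | exists k, exists2 x, simplex x & pi k x = y /\ side k = b].
have openA b : open (A b).
  apply/pi_open => l; apply/open_subspaceP.
  have [lb|lb] := eqVneq (side l) b.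
    exists setT; first exact: openT.
    by apply/seteqP; split=> x [_ sx]; split=> //; exists l, x.
  exists set0; first exact: open0.
  apply/seteqP; split=> x [] // [k [y sy [kl kb]]] sx.
  by move: lb; rewrite -kb (side_pi k l y x) ?eqxx.
have AC b : ~` A b = A (~~ b).
  apply/seteqP; split=> y.
    have [k [x sx kx]] := piS y => nAy; exists k, x => //; split=> //.
    have : side k != b by apply/eqP => kb; apply: nAy; exists k, x.
    by case: (side k); case: (b).
  move=> [k [x sx [kx kb]]] [l [x' sx' [lx lb]]].
  have := side_pi k l x x' sx sx' (etrans kx (esym lx)).
  by rewrite kb lb; case: (b).
move=> k l; have [m qm] := qS (pi k (delta_mx ord0 ord0)).
have [m' qm'] := qS (pi l (delta_mx ord0 ord0)).
have inA h : A (side h) (pi h (delta_mx ord0 ord0)).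
  by exists h, (delta_mx ord0 ord0) => //; apply: simplex_delta.
have AT : q @^-1` A (side k) = setT.
  apply: connectedM.
  - by exists m; rewrite /= qm; exact: inA.
  - by exists (q @^-1` A (side k)); rewrite ?setTI //; apply/q_open.
  - exists (q @^-1` A (side k)); rewrite ?setTI //.
    by rewrite -[_ @^-1` _]setCK; apply: open_closedC; rewrite preimage_setC AC; apply/q_open.
have : A (side k) (q m') by rewrite -[A _ _]/((q @^-1` A (side k)) m') AT.
rewrite qm' => -[h [x sx [hx <-]]]; apply: side_pi hx => //.
exact: simplex_delta.
Qed.
End Connectedness.

(** * The 1-skeleton *)

Section OneSkeleton.
Variables (K : finType) (G : gluing K) (rep : cell1 G -> oedge K).
Hypothesis repP : oriented_representatives rep.
Hypothesis connectedK : forall side : K -> bool,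
  (forall k j, side (nbr G k j) = side k) -> forall k l, side k = side l.

(** If no 1-cell leaves S, then all vertices of a simplex lie on the same side of S,
    and so do those of two glued simplices, which share a vertex. *)
Lemma skeleton_connected (S : {set cell0 G}) :
    S != finset.set0 -> S != [set: cell0 G]%SET ->
  exists e, (start rep e \in S) != (finish rep e \in S).
Proof.
move=> S0 ST; apply: contrapT => noE.
have sameE e : (start rep e \in S) = (finish rep e \in S).
  by apply/eqP; apply: contra_notT noE => se; exists e.
have same k a b : (cell0_of G (k, a) \in S) = (cell0_of G (k, b) \in S).
  have [->//|ab] := eqVneq a b.
  have := sameE (cell1_of G (edge k a b ab)).
  by case: (ends_cell1_of repP (edge k a b ab)); rewrite /tail /head /= => -[-> ->].
have side_nbr k j : (cell0_of G (nbr G k j, ord0) \in S) = (cell0_of G (k, ord0) \in S).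
  have [l lj] : exists l : 'I_4, j != l.
    by case: (eqVneq j ord0) => [->|j0]; [exists ord_max | exists ord0].
  rewrite (same k ord0 l) (same (nbr G k j) ord0 (gperm G k j l)).
  suff -> : cell0_of G (k, l) = cell0_of G (nbr G k j, gperm G k j l) by [].
  by apply: cell0_of_step; apply/existsP; exists j; rewrite lj eqxx.
have allS x y : (cell0_of G x \in S) = (cell0_of G y \in S).
  case: x y => [k a] [l b]; rewrite (same k a ord0) (same l b ord0).
  exact: (connectedK (side := fun k => cell0_of G (k, ord0) \in S)).
have cell0P (u : cell0 G) : exists x, u = cell0_of G x.
  by case: u => A AP; have /imsetP[x _ AE] := AP; exists x; apply: val_inj.
have [u uS] := set0Pn _ S0.
case/negP: ST; apply/eqP/setP => w; rewrite finset.in_setT.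
have [x ux] := cell0P u; have [y ->] := cell0P w.
by rewrite (allS y x) -ux.
Qed.

(** Two of the vertices 0, 1, 2 of a simplex have the same colour. *)
Lemma skeleton_not_bipartite (k : K) (col : cell0 G -> bool) :
  exists e, col (start rep e) = col (finish rep e).
Proof.
apply: contrapT => noE.
have diff a b : a != b -> col (cell0_of G (k, a)) != col (cell0_of G (k, b)).
  move=> ab; apply: contra_notN noE => /eqP cab.
  exists (cell1_of G (edge k a b ab)); move: cab.
  by case: (ends_cell1_of repP (edge k a b ab)); rewrite /tail /head /= => -[-> ->].
have := diff 0 1 isT; have := diff 1 2%:R isT; have := diff 0 2%:R isT.
by do 3 case: (col _).
Qed.
End OneSkeleton.

(** * The reduced Ptolemy variety *)

Theorem proposition1p15
  (R : realType)
  (M Mhat : topologicalType) (atlas : set (chart R M)) (q : M -> Mhat)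
  (K : finType) (G : gluing K) (pi : K -> 'rV[R]_4 -> Mhat)
  (sigma : K -> 'I_4 -> 'Z_2) (rep : cell1 G -> oedge K)
  (hM : compact_connected_oriented_3manifold atlas)
  (hMhat : collapses_boundary R q)
  (hT : ideal_triangulation G q pi)
  (hTor : oriented_triangulation atlas q pi)
  (hsigma : cocycle R G sigma)
  (hrep : oriented_representatives rep) :
  exists2 eps : 'I_#|cell0 G| -> cell1 G, injective eps &
    isomorphism (fun c : slice_variety R rep sigma eps =>
      quotient_map (slice_inclusion c)).
Proof.
have [_ _ connM [m _] _] := hM.
have [piS _ _ _] := hT; have [k _] := piS (q m).
have connK := gluing_connected hMhat hT connM.
have [eps [eps_inj epsS epsM]] := odd_spanning_subgraph R[i]
  (skeleton_connected hrep connK) (skeleton_not_bipartite hrep k) (cell0_of G (k, ord0)).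
by exists eps => //; apply: slice_isomorphism.
Qed.
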